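(* Let $(X,T)$ be a topological dynamical system, $f\in C(X)$ a continuous real-valued function, and $S:(0,1)\to(0,\infty)$ a scale function. Then $$Sdim(X,T,f,S)=PSdim(X,T,f,S).$$ If in addition $f\geq 0$ and $S$ is non-increasing, then $$Sdim(X,T,f,S)=PPSdim(X,T,f,S).$$ Here $Sdim$ is the scaled pressure, $PSdim$ is the scaled pressure with respect to pseudo-orbits, and $PPSdim$ is the scaled pressure with respect to periodic pseudo-orbits.
   Context: A topological dynamical system (TDS) is a pair $(X,T)$ where $X$ is a compact metric space with metric $d$ and $T:X\to X$ is a continuous map. Elements of $X^{\mathbb N}$ are sequences $\mathbf x=(x_0,x_1,\ldots)$ indexed from $0$. Convention: $\log 0=-\infty$. A function $S:(0,1)\to(0,\infty)$ is a scale function if $\lim_{x\to0}\frac{S(\lambda x)}{S(x)}=1$ for every $\lambda\in(0,\infty)$. Spanning and separated sets in $X$. Let $d_n(x,y)=\max_{0\leq i\leq n-1}d(T^ix,T^iy)$. A set $E\subset X$ is an $(n,\epsilon)$-separated set of $X$ if $d_n(x,y)>\epsilon$ for all $x\neq y$ in $E$; $F\subset X$ is an $(n,\epsilon)$-spanning set of $X$ if for every $x\in X$ there is $y\in F$ with $d_n(x,y)\leq\epsilon$. Scaled pressure. Define $$Spa_{n,\epsilon}=\inf\Big\{\sum_{x\in F}e^{S(\epsilon)\sum_{i=0}^{n-1}f(T^ix)}:F\text{ is an }(n,\epsilon)\text{-spanning set of }X\Big\},$$ $$Sep_{n,\epsilon}=\sup\Big\{\sum_{x\in E}e^{S(\epsilon)\sum_{i=0}^{n-1}f(T^ix)}:E\text{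 is an }(n,\epsilon)\text{-separated set of }X\Big\},$$ $$Sdim(X,T,f,S)=\limsup_{\epsilon\to0}\frac{\limsup_{n\to\infty}\frac1n\log Spa_{n,\epsilon}}{S(\epsilon)}=\limsup_{\epsilon\to0}\frac{\limsup_{n\to\infty}\frac1n\log Sep_{n,\epsilon}}{S(\epsilon)}.$$ Pseudo-orbits. For $\alpha>0$, $PO_\alpha$ is the set of $\alpha$-pseudo-orbits, i.e. of $(x_0,x_1,\ldots)\in X^{\mathbb N}$ with $d(Tx_i,x_{i+1})\leq\alpha$ for all $i\geq0$. For $n\geq1$, $PPO_{n,\alpha}=\{\mathbf x\in PO_\alpha:x_{n+k}=x_k\text{ for all }k\geq 0\}$ is the set of $n$-periodic $\alpha$-pseudo-orbits. Spanning and separated sets in $X^{\mathbb N}$. For $Y\subset X^{\mathbb N}$, a set $E\subset Y$ is an $(n,\epsilon)$-separated set of $Y$ if for all $\mathbf x\neq\mathbf y$ in $E$ there is $0\leq i\leq n-1$ with $d(x_i,y_i)>\epsilon$; $F\subset Y$ is an $(n,\epsilon)$-spanning set of $Y$ if for every $\mathbf x\in Y$ there is $\mathbf y\in F$ with $d(x_i,y_i)<\epsilon$ for $0\leq i\leq n-1$. Scaled pressure with respect to pseudo-orbits. Define $$POSpa_{n,\epsilon,\alpha}=\inf\Big\{\sum_{\mathbf x\in F}e^{S(\epsilon)\sum_{i=0}^{n-1}f(x_i)}:F\text{ is an }(n,\epsilon)\text{-spanning set of }PO_\alpha\Big\},$$ $$POSep_{n,\epsilon,\alpha}=\sup\Big\{\sum_{\mathbf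 x\in E}e^{S(\epsilon)\sum_{i=0}^{n-1}f(x_i)}:E\text{ is an }(n,\epsilon)\text{-separated set of }PO_\alpha\Big\},$$ and define $PPOSpa_{n,\epsilon,\alpha}$ and $PPOSep_{n,\epsilon,\alpha}$ by the same formulas with $PO_\alpha$ replaced by $PPO_{n,\alpha}$. Then $$PSdim(X,T,f,S)=\limsup_{\epsilon\to0}\frac{\lim_{\alpha\to0}\limsup_{n\to\infty}\frac1n\log POSep_{n,\epsilon,\alpha}}{S(\epsilon)},$$ $$PPSdim(X,T,f,S)=\limsup_{\epsilon\to0}\frac{\lim_{\alpha\to0}\limsup_{n\to\infty}\frac1n\log PPOSep_{n,\epsilon,\alpha}}{S(\epsilon)}.$$ The definitions also give, as equal expressions, the same formulas with $POSpa$, $PPOSpa$ in place of $POSep$, $PPOSep$; the separated-set expressions may be taken as the definition (there the limit in $\alpha$ exists by monotonicity). *)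

(* Defs.v *)
From HB Require Import structures.
From mathcomp Require Import all_boot all_order all_algebra.
From mathcomp Require Import all_classical all_reals all_analysis.

Set Implicit Arguments.
Unset Strict Implicit.
Unset Printing Implicit Defensive.

Import Order.TTheory GRing.Theory Num.Theory.
Import numFieldNormedType.Exports.

Local Open Scope classical_set_scope.
Local Open Scope ring_scope.

(* S is a total function on R of which only the restriction to (0,1) is
   meaningful: nothing is assumed outside (0,1), and the limits below are taken
   along 0^'+, which only sees (0,1). *)
Definition scale_function (R : realType) (S : R -> R) : Prop :=
  (forall x : R, 0 < x < 1 -> 0 < S x) /\
  (forall lambda : R, 0 < lambda -> S (lambda * x) / S x @[x --> 0^'+] --> (1 : R)).

Section Separated.
Context {R : realType} {X : metricType R}.
Implicit Types (T : X -> X) (n : nat) (eps alpha : R).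

Definition bowen_dist T n (x y : X) : R :=
  \big[Num.max/0]_(i < n) mdist (iter i T x) (iter i T y).

Definition bowen_separated T n eps (E : set X) : Prop :=
  forall x y, E x -> E y -> x <> y -> eps < bowen_dist T n x y.

Definition PO T alpha : set (nat -> X) :=
  [set x | forall i, mdist (T (x i)) (x i.+1) <= alpha].

Definition PPO T n alpha : set (nat -> X) :=
  [set x | PO T alpha x /\ forall k, x (n + k)%N = x k].

Definition seq_separated n eps (Y E : set (nat -> X)) : Prop :=
  E `<=` Y /\
  forall x y, E x -> E y -> x <> y ->
    exists2 i, (i < n)%N & eps < mdist (x i) (y i).

End Separated.

Section ScaledPressure.
Local Open Scope ereal_scope.
Context {R : realType} {X : metricType R}.
Variables (T : X -> X) (f : X -> R) (S : R -> R).
Implicit Types (n : nat) (eps alpha : R).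

Definition Sep n eps : \bar R :=
  ereal_sup [set \esum_(x in E)
                   (expR (S eps * \sum_(i < n) f (iter i T x))%R)%:E
            | E in bowen_separated T n eps].

Definition seqSep n eps (Y : set (nat -> X)) : \bar R :=
  ereal_sup [set \esum_(x in E) (expR (S eps * \sum_(i < n) f (x i))%R)%:E
            | E in seq_separated n eps Y].

Definition POSep n eps alpha : \bar R := seqSep n eps (PO T alpha).

Definition PPOSep n eps alpha : \bar R := seqSep n eps (PPO T n alpha).

(* lne 0 = -oo; the junk value at n = 0 does not affect the limsup. *)
Definition growth_rate (a : nat -> \bar R) : \bar R :=
  limn_esup (fun n => (n%:R^-1)%:E * lne (a n)).

Definition Sdim : \bar R :=
  limf_esup (fun eps => growth_rate (fun n => Sep n eps) / (S eps)%:E) 0^'+.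

(* The limits in alpha exist: PO T alpha and PPO T n alpha are nondecreasing
   in alpha. *)
Definition PSdim : \bar R :=
  limf_esup (fun eps =>
    lim (growth_rate (fun n => POSep n eps alpha) @[alpha --> 0^'+])
      / (S eps)%:E) 0^'+.

Definition PPSdim : \bar R :=
  limf_esup (fun eps =>
    lim (growth_rate (fun n => PPOSep n eps alpha) @[alpha --> 0^'+])
      / (S eps)%:E) 0^'+.

End ScaledPressure.

(* Main.v *)
Require Import Defs.
From mathcomp Require Import all_boot all_order all_algebra.
From mathcomp Require Import all_classical all_reals all_analysis.
From mathcomp Require Import lra ring zify.
Import Order.TTheory GRing.Theory Num.Theory.
Import numFieldNormedType.Exports.
Local Open Scope classical_set_scope.
Local Open Scope ring_scope.
Set Implicit Arguments.
Unset Strict Implicit.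
Unset Printing Implicit Defensive.

(** The three quantities are exponential growth rates of one kind of sum, taken
    over separated subsets of three sets of sequences: orbits, pseudo-orbits and
    periodic pseudo-orbits.  Orbits and periodic pseudo-orbits are both
    pseudo-orbits, which gives [Sdim_le_PSdim] and [PPSdim_le_PSdim].  Two
    converse bounds are needed.  In each of them the scale [eps] is multiplied by
    a constant and an error [o(S eps)] appears, the latter because [f] is
    uniformly continuous and bounded; since [S] is a scale function, neither is
    visible in the upper limit after division by [S eps]
    ([limf_esup_scaled_le]).

    Growth rates are bounded from above through weighted covers ([covered]): a
    set of sequences is cut into finitely many pieces of [d_n]-diameter at most
    [e].  A separated set meets each piece at most once
    ([esum_separated_le]), covers multiply under concatenation of sequences
    with no loss in [e] ([covered_cat]), and, by taking balls around a maximal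
    separated set, separated sums produce covers ([covered_seqSep]).

    Pseudo-orbits grow no faster than orbits ([PSdim_le_Sdim]).  Take a time [m]
    at which the sum over orbits is at most [exp (c * m)].  For [alpha] small
    with respect to [m], every block of length [m] of a pseudo-orbit is shadowed
    by an orbit, so the blocks have a cover of cost about [exp (c * m)], and
    concatenating [n / m] blocks gives about [exp (c * n)]
    ([covered_PO_rate]).

    Orbits grow no faster than periodic pseudo-orbits ([Sdim_le_PPSdim]).  An
    orbit segment that comes back to the ball of radius [alpha / 2] from which it
    started is one period of a periodic [alpha]-pseudo-orbit.  Cover the space by
    finitely many such balls and remove them one at a time: between its first
    and its last visit to a given ball an orbit makes a single return, and
    before and after it is confined to the remaining balls.  An orbit segment of
    length [n] is thus a concatenation of boundedly many returns and single
    points, with polynomially many possible cutting times, so that the growth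
    rate of returns bounds that of orbits ([covered_confined]). *)

(** * Weighted covers of sets of sequences *)

Section Cover.
Context {R : realType} {X : metricType R} (f : X -> R).
Implicit Types (x y c : nat -> X) (Y Z E F : set (nat -> X)).
Implicit Types (s e B w k : R) (n m : nat).

Definition weight s n x : R := expR (s * \sum_(i < n) f (x i)).

Definition seq_close n e x y := forall i, (i < n)%N -> mdist (x i) (y i) <= e.

Definition seq_shift m x : nat -> X := fun i => x (m + i)%N.

(** The weighted cost of covering [Y] by finitely many sets of
    [d_n]-diameter at most [e], each piece being charged a bound of the weights
    of its points.  Unlike spanning or separated sets, such covers multiply
    under concatenation of sequences without any loss in [e]; this is what
    makes them suited to products of unboundedly many blocks. *)
Inductive covered s n e : set (nat -> X) -> R -> Prop :=
| covered_piece Y w of 0 <= w & (forall x, Y x -> weight s n x <= w)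
    & (forall x y, Y x -> Y y -> seq_close n e x y) : covered s n e Y w
| coveredU Y1 Y2 B1 B2 of covered s n e Y1 B1 & covered s n e Y2 B2 :
    covered s n e (Y1 `|` Y2) (B1 + B2)
| covered_le Y Y' B B' of covered s n e Y' B' & Y `<=` Y' & B' <= B :
    covered s n e Y B.

Lemma weight_gt0 s n x : 0 < weight s n x.
Proof. exact: expR_gt0. Qed.

Lemma weightD s n m x :
  weight s (n + m) x = weight s n x * weight s m (seq_shift n x).
Proof. by rewrite /weight big_split_ord /= mulrDr expRD. Qed.

Lemma seq_closeD n m e x y : seq_close n e x y -> seq_close m e (seq_shift n x) (seq_shift n y) ->
  seq_close (n + m) e x y.
Proof.
move=> cn cm i inm; case: (ltnP i n) => [|ni]; first exact: cn.
by have := cm (i - n)%N; rewrite /seq_shift subnKC//; apply; lia.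
Qed.

Lemma covered_ge0 s n e Y B : covered s n e Y B -> 0 <= B.
Proof.
elim=> {Y B} // [Y1 Y2 B1 B2 _ ? _ ?|Y Y' B B' _ B'0 _]; first exact: addr_ge0.
exact: le_trans.
Qed.

Lemma covered0 s n e : covered s n e set0 0.
Proof. by apply: covered_piece. Qed.

Lemma covered_length0 s e Y : covered s 0 e Y 1.
Proof. by apply: covered_piece => // x _; rewrite /weight big_ord0 mulr0 expR0. Qed.

Lemma covered_bigcup s n e (Y : nat -> set (nat -> X)) B N :
  (forall i, (i < N)%N -> covered s n e (Y i) B) ->
  covered s n e [set x | exists2 i, (i < N)%N & Y i x] (N%:R * B).
Proof.
elim: N => [_|N IH cY].
  by rewrite mul0r; apply: covered_le (covered0 s n e) _ _ => // x [].
apply: covered_le (coveredU (IH _) (cY N _)) _ _ => //.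
- by move=> i iN; apply: cY; rewrite ltnS ltnW.
- move=> x [i iN Yx]; case: (ltnP i N) => [|Ni]; first by left; exists i.
  by right; have -> : N = i by lia.
- by rewrite -natr1 mulrDl mul1r.
Qed.

(** Refining a cover of the first [n] coordinates by a cover of the next [m]
    coordinates keeps the diameters and multiplies the costs. *)
Lemma covered_cat s n m e Y Z B C : covered s n e Y B -> covered s m e Z C ->
  covered s (n + m) e [set x | Y x /\ Z (seq_shift n x)] (B * C).
Proof.
move=> cY cZ; have C0 := covered_ge0 cZ.
elim: cY => {Y B} [Y w w0 Yw Ye|Y1 Y2 B1 B2 _ cY1 _ cY2|Y Y' B B' _ cY' YY' B'B].
- elim: cZ {C0} => {Z C} [Z v v0 Zv Ze|Z1 Z2 C1 C2 _ cZ1 _ cZ2|Z Z' C C' _ cZ' ZZ' C'C].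
  + apply: covered_piece; first exact: mulr_ge0.
      move=> x [Yx Zx]; rewrite weightD.
      by apply: ler_pM; rewrite ?(ltW (weight_gt0 _ _ _))//; [exact: Yw|exact: Zv].
    by move=> x y [Yx Zx] [Yy Zy]; apply: seq_closeD; [exact: Ye|exact: Ze].
  + rewrite mulrDr; apply: covered_le (coveredU cZ1 cZ2) _ _ => //.
    by move=> x [Yx [Zx|Zx]]; [left|right].
  + apply: covered_le cZ' _ _; last exact: ler_wpM2l.
    by move=> x [Yx /ZZ'].
- rewrite mulrDl; apply: covered_le (coveredU cY1 cY2) _ _ => //.
  by move=> x [[Yx|Yx] Zx]; [left|right].
- apply: covered_le cY' _ _; last exact: ler_wpM2r.
  by move=> x [/YY'].
Qed.

Lemma covered_pow s n e Y B q : covered s n e Y B ->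
  covered s (q * n) e [set x | forall j, (j < q)%N -> Y (seq_shift (j * n) x)] (B ^+ q).
Proof.
move=> cY; elim: q => [|q IH]; first by rewrite expr0; exact: covered_length0.
rewrite exprSr mulSn addnC; apply: covered_le (covered_cat IH cY) _ _ => //.
by move=> x /= Yx; split=> [j jq|]; apply: Yx; lia.
Qed.

(** Covers are pulled back along maps that move sequences little and lose a
    bounded factor of weight: shadowing uses this with [d > 0], passing to a
    periodic sequence with the same first [n] terms uses it with [d = 0]. *)
Lemma covered_perturb s n e d k (phi : (nat -> X) -> nat -> X) Y Z B :
  covered s n e Y B -> 0 <= k -> 
  (forall x, Z x -> Y (phi x)) ->
  (forall x, Z x -> seq_close n d x (phi x)) ->
  (forall x, Z x -> weight s n x <= k * weight s n (phi x)) ->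
  covered s n (e + 2 * d) Z (k * B).
Proof.
move=> cY k0 ZY Zd Zk.
suff H : covered s n (e + 2 * d) [set x | Z x /\ Y (phi x)] (k * B).
  by apply: covered_le H _ _ => // x Zx; split=> //; exact: ZY.
elim: cY {ZY} => {Y B} [Y w w0 Yw Ye|Y1 Y2 B1 B2 _ cY1 _ cY2|Y Y' B B' _ cY' YY' B'B].
- apply: covered_piece; first exact: mulr_ge0.
    by move=> x [Zx Yx]; apply: le_trans (Zk x Zx) _; apply: ler_wpM2l => //; exact: Yw.
  move=> x y [Zx Yx] [Zy Yy] i im.
  have := Zd x Zx i im; have := Zd y Zy i im; have := Ye _ _ Yx Yy i im.
  have := metric_triangle (x i) (phi x i) (y i).
  have := metric_triangle (phi x i) (phi y i) (y i).
  rewrite (metric_sym (phi y i)); lra.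
- rewrite mulrDr; apply: covered_le (coveredU cY1 cY2) _ _ => //.
  by move=> x [Zx [Yx|Yx]]; [left|right].
- apply: covered_le cY' _ _; last exact: ler_wpM2l.
  by move=> x [Zx /YY'].
Qed.

Lemma seq_separatedS n e Y E F :
  seq_separated n e Y E -> F `<=` E -> seq_separated n e Y F.
Proof.
move=> [EY sE] FE; split; first exact: subset_trans EY.
by move=> x y /FE Ex /FE Ey; exact: sE.
Qed.

(** A piece of diameter at most [e] holds at most one point of a separated
    set. *)
Lemma esum_separated_le s n e Y Z E B : covered s n e Y B ->
  seq_separated n e Z E -> E `<=` Y -> (\esum_(x in E) (weight s n x)%:E <= B%:E)%E.
Proof.
have w0 x : (0%R <= (weight s n x)%:E)%E by rewrite lee_fin ltW// weight_gt0.
move=> cY; elim: cY E => {Y B} [Y w w_ge0 Yw Ye|Y1 Y2 B1 B2 _ IH1 _ IH2|Y Y' B B' _ IH YY' B'B] E sE EY.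
- have [->|/set0P[x Ex]] := eqVneq E set0; first by rewrite esum_set0 lee_fin.
  suff -> : E = [set x] by rewrite esum_set1// lee_fin; apply/Yw/EY.
  apply/seteqP; split=> [y Ey|y -> //]; apply: contrapT => yx.
  have [i im] := sE.2 _ _ Ey Ex yx.
  by rewrite ltNge (Ye _ _ (EY _ Ey) (EY _ Ex) i im).
- rewrite (esumID Y1)//; rewrite EFinD; apply: leeD.
    by apply: IH1; [apply: seq_separatedS sE _; exact: subIsetl|exact: subIsetr].
  apply: IH2; first by apply: seq_separatedS sE _; exact: subIsetl.
  by move=> x [/EY[]].
- apply: le_trans (IH E sE _) _; first exact: subset_trans YY'.
  by rewrite lee_fin.
Qed.

(** A finite cover bounds the size of separated sets, so that a separated set
    can be enlarged, one piece at a time, until it is [e]-dense; the balls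
    around its points then form a cover whose cost is compared to the sum over
    the separated set. *)
Lemma covered_by_separated s s' n e Z D k : 0 <= e -> 0 <= k ->
  covered s n e setT D ->
  (forall x c, seq_close n e x c -> weight s n x <= k * weight s' n c) ->
  exists F b, [/\ seq_separated n e Z F, covered s n (2 * e) Z b &
    (b%:E <= k%:E * \esum_(x in F) (weight s' n x)%:E)%E].
Proof.
move=> e0 k0 cT ke.
have w0 x : (0%R <= (weight s' n x)%:E)%E by rewrite lee_fin ltW// weight_gt0.
pose nb F := [set x | exists2 c, F c & seq_close n e x c].
pose good F := seq_separated n e Z F /\ exists2 b, covered s n (2 * e) (nb F) b &
    (b%:E <= k%:E * \esum_(x in F) (weight s' n x)%:E)%E.
suff H F0 : good F0 -> exists F, [/\ good F, F0 `<=` F & setT `&` Z `<=` nb F].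
  have [|F [[sF [b cb bF]] _ ZF]] := H set0.
    split; first by split=> //.
    exists 0; last by rewrite esum_set0 mule0.
    by apply: covered_le (covered0 _ _ _) _ _ => // x [].
  by exists F, b; split=> //; apply: covered_le cb _ _ => // x Zx; exact: ZF.
elim: cT F0 => {D} [Y w w_ge0 Yw Ye|Y1 Y2 B1 B2 _ IH1 _ IH2|Y Y' B B' _ IH YY' B'B] F0 gF0.
- have [[x [Yx Zx] Fx]|noY] := pselect (exists2 x, (Y `&` Z) x & ~ nb F0 x); last first.
    exists F0; split=> // x YZx; apply: contrapT => nx; by apply: noY; exists x.
  have F0x : ~ F0 x.
    by move=> F0x; apply: Fx; exists x => // i _; rewrite mdistxx.
  have far y : F0 y -> exists2 i, (i < n)%N & e < mdist (x i) (y i).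
    move=> F0y; apply: contrapT => H; apply: Fx; exists y => // i im.
    by rewrite leNgt; apply/negP => lt; apply: H; exists i.
  exists (x |` F0); split; last 2 first.
  + by move=> y; right.
  + by move=> y [Yy Zy]; exists x; [left|exact: Ye].
  case: gF0 => -[F0Z sF0] [b cb bF0]; split.
    split=> [y [->|/F0Z]//|y z [->|F0y] [->|F0z] yz //].
    * exact: far.
    * have [i im] := far _ F0y; rewrite metric_sym; by exists i.
    * exact: sF0.
  exists (k * weight s' n x + b).
    apply: covered_le (coveredU (Y1 := [set y | seq_close n e y x]) _ cb) _ (lexx _).
      apply: covered_piece.
      * by rewrite mulr_ge0// ltW// weight_gt0.
      * by move=> y; exact: ke.
      * move=> y z cy cz i im; have := cy i im; have := cz i im.
        have := metric_triangle (y i) (x i) (z i).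
        rewrite (metric_sym (z i)); lra.
    by move=> y [c [->|F0c] cl]; [left|right; exists c].
  rewrite (esumID [set x])//.
  have -> : (x |` F0) `&` [set x] = [set x].
    by apply/seteqP; split=> y [] //= ->; split=> //; left.
  have -> : (x |` F0) `&` ~` [set x] = F0.
    apply/seteqP; split=> y; first by case=> [[-> /(_ erefl)|]].
    by move=> F0y; split; [right|move=> /= yx; apply: F0x; rewrite -yx].
  rewrite esum_set1// ge0_muleDr// ?esum_ge0// EFinD leeD//.
- have [F1 [gF1 F01 Y1F1]] := IH1 _ gF0.
  have [F2 [gF2 F12 Y2F2]] := IH2 _ gF1.
  exists F2; split=> //; first exact: subset_trans F12.
  move=> x [[Yx|Yx] Zx]; last exact: Y2F2.
  by have [c Fc ?] := Y1F1 x (conj Yx Zx); exists c => //; exact: F12.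
- have [F [gF F0F YF]] := IH _ gF0.
  by exists F; split=> // x [/YY' Yx Zx]; exact: YF.
Qed.

End Cover.

(** * Upper limits and growth rates *)

Section Growth.
Context {R : realType}.
Implicit Types (a : nat -> \bar R) (c k D : R).

Lemma limf_esup_le (T : choiceType) (U : filteredType T) (u : U -> \bar R)
    (F : set_system U) (c : \bar R) :
  (\forall x \near F, u x <= c)%E -> (limf_esup u F <= c)%E.
Proof.
move=> Fu; apply: le_trans (ereal_inf_lbound _) _; first by exists [set x | (u x <= c)%E].
by apply: ge_ereal_sup => _ [x ux <-].
Qed.

Lemma limf_esup_lt (T : choiceType) (U : filteredType T) (u : U -> \bar R)
    (F : set_system U) (c : \bar R) : Filter F ->
  (limf_esup u F < c)%E -> (\forall x \near F, u x < c)%E.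
Proof.
move=> FF /ereal_inf_lt[_ [V FV <-]] Vc; apply: filterS FV => x Vx.
by apply: le_lt_trans Vc; apply: ereal_sup_ubound; exists x.
Qed.

Lemma le_limf_esup (T : choiceType) (U : filteredType T) (u v : U -> \bar R)
    (F : set_system U) : Filter F ->
  (\forall x \near F, u x <= v x)%E -> (limf_esup u F <= limf_esup v F)%E.
Proof.
move=> FF Fuv; apply: le_ereal_inf_tmp => _ [V FV <-].
apply: limf_esup_le; apply: filterS2 Fuv FV => x uv Vx.
by apply: le_trans uv _; apply: ereal_sup_ubound; exists x.
Qed.

Lemma le_lne (x y : \bar R) : (x <= y -> lne x <= lne y)%E.
Proof.
move=> xy; case: (leP x 0%E) => [x0|x0]; first by rewrite le0_lneNy// leNye.
by rewrite lee_lne// in_itv/= leey andbT ltW// (lt_le_trans x0).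
Qed.

Lemma le_growth_rate a a' : (forall n, a n <= a' n)%E ->
  (growth_rate a <= growth_rate a')%E.
Proof.
move=> aa'; apply: le_limf_esup; apply: nearW => n.
by apply: lee_wpmul2l; rewrite ?lee_fin ?invr_ge0//; exact: le_lne.
Qed.

Lemma growth_rate_le a D c : (forall n, a n <= (D * expR (c * n%:R))%:E)%E ->
  (growth_rate a <= c%:E)%E.
Proof.
move=> aD; pose E := Num.max D 1.
have E0 : 0 < E by rewrite lt_max ltr01 orbT.
apply/lee_addgt0Pr => eta eta0; apply: limf_esup_le.
near=> n.
have n0 : 0 < n%:R :> R by rewrite ltr0n; near: n; exact: nbhs_infty_gt.
have nE : ln E / eta <= n%:R by near: n; exact: nbhs_infty_ger.
rewrite -EFinD lee_pdivrMl// -EFinM mulrC mulrDl.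
have aE : (a n <= (E * expR (c * n%:R))%:E)%E.
  apply: le_trans (aD n) _.
  by rewrite lee_fin ler_pM2r ?expR_gt0// le_max lexx.
apply: le_trans (le_lne aE) _.
rewrite lne_EFin ?mulr_gt0 ?expR_gt0// lnM ?posrE ?expR_gt0// expRK lee_fin.
by rewrite addrC lerD2l mulrC -ler_pdivrMr.
Unshelve. all: by end_near. Qed.

Lemma growth_rate_lt a c : (growth_rate a < c%:E)%E ->
  exists2 N, (0 < N)%N & forall n, (N <= n)%N -> (a n <= (expR (c * n%:R))%:E)%E.
Proof.
move=> /limf_esup_lt [N _ Na]; exists N.+1 => // n Nn.
have n0 : 0 < n%:R :> R by rewrite ltr0n; exact: leq_trans Nn.
have := Na n (ltnW Nn); rewrite /= lte_pdivrMl// => an.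
rewrite leNgt; apply/negP => lt.
have : (lne (expR (c * n%:R))%:E < lne (a n))%E.
  have e0 : (0 <= (expR (c * n%:R))%:E)%E by rewrite lee_fin ltW// expR_gt0.
  by rewrite lte_lne// in_itv/= leey andbT// (le_trans e0 (ltW lt)).
by rewrite lne_EFin ?expR_gt0// expRK mulrC EFinM ltNge (ltW an).
Qed.

End Growth.

(** * Compactness *)

Section Compact.
Context {R : realType} {X : metricType R} (X_compact : compact [set: X]).

Lemma compact_totally_bounded (r : R) : 0 < r ->
  exists L : seq X, forall x, exists2 c, c \in L & mdist c x < r.
Proof.
move=> r0.
pose F := [set A : set (seq X) | exists s0 : seq X, forall s : seq X, {subset s0 <= s} -> A s].
have FF : Filter F.
  split; first by exists [::].
  - move=> A B [sA HA] [sB HB]; exists (sA ++ sB) => s sub; split.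
      by apply: HA => z zA; apply: sub; rewrite mem_cat zA.
    by apply: HB => z zB; apply: sub; rewrite mem_cat zB orbT.
  - by move=> A B AB [sA HA]; exists sA => s /HA /AB.
(* Being within [r] of a finite list of points is a local property that holds
   for all long enough lists; compactness makes it hold everywhere for a
   single list. *)
have /compact_near_coveringP/(_ _ F
  (fun L x => exists2 c, c \in L & mdist c x < r) FF) := X_compact.
case=> [x _|L /(_ L (fun _ => id)) H].
  exists (ball x r, [set L : seq X | x \in L]) => /=.
    split; first exact: nbhsx_ballx.
    by exists [:: x] => s; apply; rewrite inE.
  by move=> [y L] /= []; rewrite ballEmdist /= => xy xL; exists x.
by exists L => x; exact: H.
Qed.

Lemma compact_uniform_continuity (M : pseudoMetricType R) (g : X -> M) (e : R) :
  continuous g -> 0 < e ->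
  exists2 d : R, 0 < d & forall x y, mdist x y < d -> ball (g x) e (g y).
Proof.
move=> g_cont e0.
have /compact_near_coveringP/(_ _ (0^'+) (fun d x =>
  forall y, mdist x y < d -> ball (g x) e (g y))) := X_compact.
case=> [x _|d /= d0 dH]; last first.
  exists (d / 2); first by rewrite divr_gt0.
  move=> x; apply: (dH (d / 2)) => //=.
    by rewrite sub0r normrN gtr0_norm ?divr_gt0// ltr_pdivrMr// ltr_pMr// ltr1n.
  by rewrite divr_gt0.
have /g_cont/nbhs_ballP[d /= d0 dH] : nbhs (g x) (ball (g x) (e / 2)).
  by apply: nbhsx_ballx; rewrite divr_gt0.
have d20 : 0 < d / 2 by rewrite divr_gt0.
exists (ball x (d / 2), [set t | t < d / 2]) => /=.
  by split; [exact: nbhsx_ballx|exact: nbhs_right_lt].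
move=> [z t] /= []; rewrite ballEmdist /= => xz td y zy.
rewrite [e]splitr; apply: (@ball_triangle _ _ (g x)).
  apply: ball_sym; apply: dH; rewrite ballEmdist /=.
  by apply: lt_trans xz _; rewrite ltr_pdivrMr// ltr_pMr// ltr1n.
apply: dH; rewrite ballEmdist /=.
have := metric_triangle x z y; lra.
Qed.

Lemma compact_bounded_fun (f : X -> R) : continuous f ->
  exists2 M, 0 <= M & forall x, `|f x| <= M.
Proof.
move=> f_cont; have [d d0 df] := compact_uniform_continuity f_cont ltr01.
have [L HL] := compact_totally_bounded d0.
exists (\sum_(c <- L) (`|f c| + 1)); first by apply: sumr_ge0 => c _; rewrite addr_ge0.
move=> x; have [c cL cx] := HL x.
rewrite (big_rem c)//=; apply: (@le_trans _ _ (`|f c| + 1)); last first.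
  by rewrite lerDl; apply: sumr_ge0 => ? _; rewrite addr_ge0.
have : `|f c - f x| < 1 := df _ _ cx.
have := ler_normB (f c) (f c - f x); rewrite opprB addrC subrK; lra.
Qed.

End Compact.

Section CompactCover.
Context {R : realType} {X : metricType R} (X_compact : compact [set: X]).
Context (f : X -> R) (M : R) (fM : forall x, `|f x| <= M).

(** The whole sequence space has finite covers, of uncontrolled cost. *)
Lemma covered_setT1 (s e : R) : 0 < e ->
  exists D, covered f s 1 e [set: nat -> X] D.
Proof.
move=> e0; have [L HL] := compact_totally_bounded X_compact (divr_gt0 e0 (ltr0Sn _ 1)).
suff [D cD] : exists D, covered f s 1 e
    [set x | exists2 c, c \in L & mdist c (x 0) < e / 2] D.
  by exists D; apply: covered_le cD _ _ => // x _; exact: HL.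
elim: L {HL} => [|c L [D cD]].
  by exists 0; apply: covered_le (covered0 _ _ _ _) _ _ => // x [].
exists (expR (`|s| * M) + D).
apply: covered_le (coveredU (Y1 := [set x | mdist c (x 0) < e / 2]) _ cD) _ (lexx _).
  apply: covered_piece.
  - by rewrite ltW// expR_gt0.
  - move=> x _; rewrite ler_expR big_ord1; apply: le_trans (ler_norm _) _.
    by rewrite normrM ler_wpM2l.
  - move=> x y /= cx cy [|//] _; have := metric_triangle (x 0) c (y 0).
    rewrite (metric_sym (x 0) c) => ?; lra.
by move=> x [b]; rewrite inE => /predU1P[->|bL] bx; [left|right; exists b].
Qed.

Lemma covered_setT (s e : R) n : 0 < e ->
  exists D, covered f s n e [set: nat -> X] D.
Proof.
move=> /(covered_setT1 s)[D /(covered_pow n)].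
by rewrite muln1 => cD; exists (D ^+ n); apply: covered_le cD _ _.
Qed.

(** Per coordinate, the error is [s * om] for moving the point and
    [M * |s - s'|] for changing the factor in the exponent. *)
Lemma weight_close (s s' e om : R) n (x c : nat -> X) : 0 <= s ->
  (forall a b, mdist a b <= e -> `|f a - f b| <= om) ->
  seq_close n e x c ->
  weight f s n x <= expR ((s * om + M * `|s - s'|) * n%:R) * weight f s' n c.
Proof.
move=> s0 fom xc; rewrite -expRD ler_expR mulr_sumr mulr_sumr.
rewrite mulr_natr -[n in _ *+ n]card_ord -sumr_const -big_split /=.
apply: ler_sum => i _.
have : f (x i) - f (c i) <= om := le_trans (ler_norm _) (fom _ _ (xc i (ltn_ord i))).
move=> /(ler_wpM2l s0).
have : (s - s') * f (c i) <= `|s - s'| * M.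
  by apply: le_trans (ler_norm _) _; rewrite normrM ler_wpM2l.
lra.
Qed.

(** The separated sums carry the factor [S e] of their own scale, while covers
    are needed with the factor [s] of a larger scale; [weight_close] converts
    between the two. *)
Lemma covered_seqSep (S : R -> R) (s e om : R) n (Z : set (nat -> X)) :
  0 < e -> 0 <= s -> (forall a b, mdist a b <= e -> `|f a - f b| <= om) ->
  exists2 b, covered f s n (2 * e) Z b &
    (b%:E <= (expR ((s * om + M * `|s - S e|) * n%:R))%:E * seqSep f S n e Z)%E.
Proof.
move=> e0 s0 fom; have [D cD] := covered_setT s n e0.
have [F [b [sF cb bF]]] := covered_by_separated Z (ltW e0) (ltW (expR_gt0 _)) cD
  (fun x c => @weight_close s (S e) e om n x c s0 fom).
exists b => //; apply: le_trans bF _; apply: lee_wpmul2l.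
  by rewrite lee_fin ltW// expR_gt0.
by apply: ereal_sup_ubound; exists F.
Qed.

Lemma seqSep_covered (S : R -> R) e n (Z : set (nat -> X)) B :
  covered f (S e) n e Z B -> (seqSep f S n e Z <= B%:E)%E.
Proof.
by move=> cB; apply: ge_ereal_sup => _ [E sE <-]; exact: esum_separated_le cB sE sE.1.
Qed.

(** A bound at each length by a sum of growth rate less than [c] becomes a
    bound that is uniform in the length: the finitely many small lengths are
    absorbed by the constant [D], their costs being finite. *)
Lemma covered_rate (s e c k : R) (Z : nat -> set (nat -> X)) (a : nat -> \bar R) :
  (forall l, exists2 b, covered f s l e (Z l) b &
    (b%:E <= (expR (k * l%:R))%:E * a l)%E) ->
  (growth_rate a < c%:E)%E ->
  exists D, forall l, covered f s l e (Z l) (D * expR ((c + k) * l%:R)).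
Proof.
move=> cYb /growth_rate_lt[N N0 aN].
have /choice[b /all_and2[cb ba]] : forall l, exists b, covered f s l e (Z l) b /\
    (b%:E <= (expR (k * l%:R))%:E * a l)%E.
  by move=> l; have [b] := cYb l; exists b.
pose t l := b l * expR (- ((c + k) * l%:R)).
have t0 l : 0 <= t l by rewrite mulr_ge0 ?(covered_ge0 (cb l))// ltW// expR_gt0.
exists (1 + \sum_(l < N) t l) => l; apply: covered_le (cb l) _ _ => //.
case: (ltnP l N) => [lN|Nl].
  have -> : b l = t l * expR ((c + k) * l%:R).
    by rewrite /t -mulrA -expRD addNr expR0 mulr1.
  rewrite ler_pM2r ?expR_gt0// (bigD1 (Ordinal lN))//=.
  by rewrite addrCA lerDl addr_ge0// sumr_ge0.
have := le_trans (ba l) (lee_wpmul2l _ (aN l Nl)).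
rewrite lee_fin ltW ?expR_gt0// => /(_ isT).
rewrite -EFinM -expRD -mulrDl (addrC k) lee_fin => /le_trans; apply.
by rewrite ler_peMl ?(ltW (expR_gt0 _))// lerDl sumr_ge0.
Qed.

End CompactCover.

(** * Orbits and pseudo-orbits *)

Section Orbits.
Context {R : realType} {X : metricType R} (T : X -> X).
Implicit Types (x y : nat -> X).

Definition orbit_seq (p : X) : nat -> X := fun i => iter i T p.

Definition orbits : set (nat -> X) := range orbit_seq.

Lemma orbits_step x i : orbits x -> x i.+1 = T (x i).
Proof. by move=> [p _ <-]. Qed.

Lemma orbits_head x : orbits x -> orbit_seq (x 0%N) = x.
Proof. by move=> [p _ <-]. Qed.

Lemma orbits_shift m x : orbits x -> orbits (seq_shift m x).
Proof.
move=> [p _ <-]; exists (iter m T p) => //; apply/funext => i.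
by rewrite /orbit_seq /seq_shift -iterD addnC.
Qed.

Lemma orbits_sub_PO (alpha : R) : 0 <= alpha -> orbits `<=` PO T alpha.
Proof. by move=> a0 x xo i; rewrite orbits_step// mdistxx. Qed.

Lemma PO_shift (alpha : R) m x : PO T alpha x -> PO T alpha (seq_shift m x).
Proof. by move=> xa i; rewrite /seq_shift addnS; exact: xa. Qed.

Lemma lt_bowen_dist n (e : R) p q : 0 <= e ->
  e < bowen_dist T n p q <->
  exists2 i, (i < n)%N & e < mdist (orbit_seq p i) (orbit_seq q i).
Proof.
move=> e0; split=> [lt|[i im lt]].
  apply: contrapT => H; move: lt; rewrite ltNge => /negP; apply.
  apply/bigmax_leP; split=> // i _; rewrite leNgt; apply/negP => lt.
  by apply: H; exists i.
apply: lt_le_trans lt _.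
exact: (le_bigmax _ (fun i : 'I_n => mdist (iter i T p) (iter i T q)) (Ordinal im)).
Qed.

(** The scaled pressure of [T] is that of its set of orbits, so that points
    and pseudo-orbits can be treated alike, as sequences. *)
Lemma Sep_orbits (f : X -> R) (S : R -> R) n (e : R) : 0 <= e ->
  Sep T f S n e = seqSep f S n e orbits.
Proof.
move=> e0; apply/eqP; rewrite eq_le; apply/andP; split.
  apply: ge_ereal_sup => _ [E sE <-]; apply: ereal_sup_ubound.
  exists (orbit_seq @` E).
    split=> [_ [p _ <-]|_ _ [p Ep <-] [q Eq <-] pq]; first by exists p.
    by apply/lt_bowen_dist => //; apply: sE => // pq'; apply: pq; rewrite pq'.
  rewrite (esum_image E orbit_seq)// => p q _ _ /(congr1 (fun x => x 0%N)).
  exact.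
apply: ge_ereal_sup => _ [E [Eo sE] <-]; apply: ereal_sup_ubound.
exists ((fun x => x 0%N) @` E).
  move=> _ _ [x Ex <-] [y Ey <-] xy; apply/lt_bowen_dist => //.
  by rewrite !orbits_head; [|exact: Eo..]; apply: sE => // xy'; apply: xy; rewrite xy'.
rewrite (esum_image E (fun x => x 0%N)); last first.
  by move=> x y /set_mem/Eo xo /set_mem/Eo yo xy; rewrite -(orbits_head xo) xy orbits_head.
apply: eq_esum => x /Eo xo; rewrite -[in RHS](orbits_head xo) //.
Qed.

Context (X_compact : compact [set: X]) (T_cont : continuous T).

Lemma shadowing (m : nat) (g : R) : 0 < g ->
  exists2 alpha : R, 0 < alpha &
    forall x, PO T alpha x -> seq_close m g x (orbit_seq (x 0%N)).
Proof.
elim: m g => [|m IH] g g0; first by exists 1.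
have g20 : 0 < g / 2 by rewrite divr_gt0.
have [d d0 Td] := compact_uniform_continuity X_compact T_cont g20.
have [al al0 sh] := IH _ (divr_gt0 d0 (ltr0Sn _ 1)).
exists (Num.min al (g / 2)); first by rewrite lt_min al0.
move=> x xPO [|i] im; first by rewrite mdistxx ltW.
have xi := xPO i; rewrite le_min in xi; case/andP: xi => _ xi.
have : mdist (x i) (orbit_seq (x 0%N) i) <= d / 2.
  by apply: sh => // j; have := xPO j; rewrite le_min => /andP[].
move=> close; have /Td : mdist (x i) (orbit_seq (x 0%N) i) < d by lra.
rewrite ballEmdist /= => ?.
have := metric_triangle (x i.+1) (T (x i)) (orbit_seq (x 0%N) i.+1).
rewrite (metric_sym (x i.+1) (T (x i))) /= -/(orbit_seq (x 0%N) i); lra.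
Qed.

Context (f : X -> R) (M : R) (fM : forall p, `|f p| <= M).
Context (S : R -> R) (s e om c : R).
Context (e0 : 0 < e) (s0 : 0 <= s).
Context (fom : forall a b, mdist a b <= e -> `|f a - f b| <= om).

(** A pseudo-orbit is cut into blocks of a fixed length [m], each of which is
    shadowed by an orbit when [alpha] is small; as the costs of covers multiply,
    the growth rate of pseudo-orbits is at most the rate reached by the orbits
    at time [m]. *)
Lemma covered_PO_rate :
  (growth_rate (fun n => seqSep f S n e orbits) < c%:E)%E ->
  exists2 alpha, 0 < alpha & exists D, forall n,
    covered f s n (4 * e) (PO T alpha)
      (D * expR ((c + 2 * (s * om) + M * `|s - S e|) * n%:R)).
Proof.
move=> /growth_rate_lt[m m0 /(_ m (leqnn m)) mc].
have [b cb bS] := covered_seqSep X_compact fM S m orbits e0 s0 fom.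
have [alpha alpha0 sh] := shadowing m e0.
exists alpha => //; set c' := c + _ + _.
have cm : covered f s m (4 * e) (PO T alpha) (expR (c' * m%:R)).
  have kw x : PO T alpha x -> weight f s m x <=
      expR ((s * om + M * `|s - s|) * m%:R) * weight f s m (orbit_seq (x 0%N)).
    by move=> /sh; exact: weight_close.
  have := covered_perturb cb (ltW (expR_gt0 _)) (fun x _ => imageT orbit_seq (x 0%N)) sh kw.
  have -> : 2 * e + 2 * e = 4 * e by ring.
  move=> cm; apply: covered_le cm _ _ => //.
  have := le_trans bS (lee_wpmul2l _ mc).
  rewrite lee_fin ltW ?expR_gt0// => /(_ isT); rewrite -EFinM lee_fin => bm.
  apply: le_trans (ler_wpM2l (ltW (expR_gt0 _)) bm) _.
  by rewrite -!expRD ler_expR /c' subrr normr0; lra.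
(* The [n %% m] times left over are covered at a cost that stays bounded. *)
have [D cD] := covered_setT1 X_compact fM s (mulr_gt0 (ltr0Sn R 3) e0).
have cD1 : covered f s 1 (4 * e) [set: nat -> X] (Num.max D 1).
  by apply: covered_le cD _ _ => //; rewrite le_max lexx.
have D1 : 1 <= Num.max D 1 by rewrite le_max lexx orbT.
exists (Num.max D 1 ^+ m * expR (`|c'| * m%:R)) => n.
have := covered_cat (covered_pow (n %/ m) cm) (covered_pow (n %% m) cD1).
rewrite muln1 -divn_eq => cn; apply: covered_le cn _ _.
  by move=> x xPO; split=> // j _; exact: PO_shift.
have nm : (n %% m <= m)%N by rewrite ltnW// ltn_pmod.
rewrite [leLHS]mulrC -mulrA ler_pM//.
- by rewrite exprn_ge0// (le_trans ler01).
- exact: ler_weXn2l.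
rewrite -expRM_natl -expRD ler_expR {2}(divn_eq n m) natrD natrM.
have : - (c' * (n %% m)%:R) <= `|c'| * m%:R.
  apply: le_trans (ler_norm _) _; rewrite normrN normrM ler_wpM2l//.
  by rewrite ger0_norm// ler_nat.
lra.
Qed.

End Orbits.

(** * Recurrence and periodic pseudo-orbits *)

Section Recurrence.
Context {R : realType} {X : metricType R} (T : X -> X).
Context (X_compact : compact [set: X]).
Context (f : X -> R) (M : R) (fM : forall p, `|f p| <= M).
Implicit Types (x y : nat -> X) (p : X) (L : seq X).

Definition returns p (r : R) l : set (nat -> X) :=
  [set x | [/\ orbits T x, mdist p (x 0%N) < r & mdist p (x l) < r]].

Definition confined L (r : R) n : set (nat -> X) :=
  [set x | orbits T x /\
    forall i, (i < n)%N -> exists2 p, p \in L & mdist p (x i) < r].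

(** An orbit segment coming back to the ball it started from, repeated for
    ever, is a periodic pseudo-orbit. *)
Lemma returns_PPO p r l x : (0 < l)%N -> returns p r l x ->
  PPO T l (2 * r) (fun k => x (k %% l)%N).
Proof.
move=> l0 [xo x0 xl]; split=> [i|k]; last by rewrite modnDl.
have r0 : 0 <= 2 * r by have := mdist_ge0 p (x 0%N); lra.
have il : (i %% l < l)%N by rewrite ltn_pmod.
rewrite -orbits_step//; have [iE|il1] := eqVneq (i %% l).+1 l.
  have -> : (i.+1 %% l = 0)%N by rewrite -addn1 -modnDml addn1 iE modnn.
  rewrite iE; have := metric_triangle (x l) p (x 0%N).
  rewrite (metric_sym (x l) p); lra.
have -> : (i.+1 %% l = (i %% l).+1)%N.
  by rewrite -addn1 -modnDml addn1 modn_small// ltn_neqAle il1.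
by rewrite mdistxx.
Qed.

Lemma covered_returns (S : R -> R) (s e om c r : R) : 0 < e -> 0 <= s ->
  (forall a b, mdist a b <= e -> `|f a - f b| <= om) ->
  (growth_rate (fun n => PPOSep T f S n e (2 * r)) < c%:E)%E ->
  exists D, forall p l, covered f s l (2 * e) (returns p r l)
    (D * expR ((c + (s * om + M * `|s - S e|)) * l%:R)).
Proof.
move=> e0 s0 fom gc.
have [D cD] := covered_rate (fun l => covered_seqSep X_compact fM S l
  (PPO T l (2 * r)) e0 s0 fom) gc.
exists (Num.max D 1) => p [|l].
  apply: covered_le (covered_length0 _ _ _ (returns p r 0)) _ _ => //.
  by rewrite mulr0 expR0 mulr1 le_max lexx orbT.
have idl x i : (i < l.+1)%N -> x (i %% l.+1)%N = x i by move=> il; rewrite modn_small.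
pose per x : nat -> X := fun k => x (k %% l.+1)%N.
have close x : returns p r l.+1 x -> seq_close l.+1 0 x (per x).
  by move=> _ i il; rewrite /per idl// mdistxx.
have same x : returns p r l.+1 x -> weight f s l.+1 x <= 1 * weight f s l.+1 (per x).
  by move=> _; rewrite mul1r ler_expR /per; under [X in _ <= _ * X]eq_bigr do rewrite idl//.
have := covered_perturb (cD l.+1) ler01 (fun x => @returns_PPO p r l.+1 x isT) close same.
rewrite mulr0 addr0 mul1r => cR; apply: covered_le cR _ _ => //.
by rewrite ler_pM2r ?expR_gt0// le_max lexx.
Qed.

Lemma natr_le_expR (eta : R) n : 0 < eta -> n%:R <= eta^-1 * expR (eta * n%:R).
Proof.
move=> eta0; rewrite -ler_pdivrMl ?invr_gt0// invrK.
by apply: le_trans (expR_ge1Dx _); rewrite lerDr.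
Qed.

(** Between its first and its last visit to the ball around [p], an orbit
    makes one return; before and after, it avoids the ball. *)
Lemma confined_cons p L r n x : confined (p :: L) r n x ->
  confined L r n x \/
  exists2 i, (i < n)%N & exists2 j, (j < n)%N &
    [/\ (i <= j)%N, confined L r i x, returns p r (j - i) (seq_shift i x) &
        confined L r (n - j.+1) (seq_shift j.+1 x)].
Proof.
move=> [xo xL].
have avoid k : (k < n)%N -> ~~ (mdist p (x k) < r) ->
    exists2 q, q \in L & mdist q (x k) < r.
  move=> /xL[q]; rewrite inE => /predU1P[->|qL] qx px; last by exists q.
  by rewrite qx in px.
pose P k := (k < n)%N && (mdist p (x k) < r).
have [exP|noP] := pselect (exists k, P k); last first.
  left; split=> // k kn; apply: avoid => //; apply/negP => px.
  by apply: noP; exists k; rewrite /P kn.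
right; have Pn k : P k -> (k <= n)%N by move=> /andP[/ltnW].
case: (ex_minnP exP) => i /andP[i_n px_i] imin.
case: (ex_maxnP exP Pn) => j /andP[jn px_j] jmax.
have ij : (i <= j)%N by apply: imin; rewrite /P jn.
exists i => //; exists j => //; split=> //.
- split=> // k ki; have kn := ltn_trans ki i_n; apply: avoid => //.
  by apply/negP => px; have := imin k; rewrite /P kn px leqNgt ki => /(_ isT).
- by split; rewrite /seq_shift ?addn0 ?subnKC//; exact: orbits_shift.
- split; first exact: orbits_shift.
  move=> k kn; have jkn : (j.+1 + k < n)%N by rewrite -ltn_subRL.
  rewrite /seq_shift; apply: avoid => //; apply/negP => px.
  by have := jmax (j.+1 + k)%N; rewrite /P jkn px => /(_ isT); lia.
Qed.

(** Deleting the balls one at a time, orbits confined to finitely many balls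
    grow no faster than returns: each deletion leaves a choice of at most
    [n ^ 2] pairs of first and last visits, paid for by an arbitrarily small
    increase of the rate. *)
Lemma covered_confined s e D0 c' r L : 0 < e ->
  (forall p l, covered f s l e (returns p r l) (D0 * expR (c' * l%:R))) ->
  forall c'', c' < c'' -> exists D, forall n,
    covered f s n e (confined L r n) (D * expR (c'' * n%:R)).
Proof.
move=> e0 cR; elim: L => [|p L IH] c'' cc.
  exists 1 => -[|n].
    by rewrite mulr0 expR0 mul1r; exact: covered_length0.
  apply: covered_le (covered0 _ _ _ _) _ _.
    by move=> x [_ /(_ 0%N isT)[]].
  by rewrite mul1r ltW// expR_gt0.
(* One third of the gap is spent on the induction hypothesis, and two thirds
   absorb the factor [n ^ 2]. *)
pose eta := (c'' - c') / 3; pose c1 := c' + eta.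
have eta0 : 0 < eta by rewrite divr_gt0// subr_gt0.
have [D cD] := IH c1 ltac:(by rewrite ltrDl).
have [D1 cD1] := covered_setT1 X_compact fM s e0.
have D_ge0 : 0 <= D by have := covered_ge0 (cD 0%N); rewrite mulr0 expR0 mulr1.
have D0_ge0 : 0 <= D0 by have := covered_ge0 (cR p 0%N); rewrite mulr0 expR0 mulr1.
have D1_ge0 := covered_ge0 cD1.
pose K := D * D0 * D1 * D * expR `|c1|.
have K0 : 0 <= K by rewrite !mulr_ge0// ltW// expR_gt0.
exists (D + K / eta ^+ 2) => n.
pose Z i j := [set x | [/\ (i <= j)%N, confined L r i x,
  returns p r (j - i) (seq_shift i x) & confined L r (n - j.+1) (seq_shift j.+1 x)]].
have cZ i j : (j < n)%N -> covered f s n e (Z i j) (K * expR (c1 * n%:R)).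
  move=> jn; case: (leqP i j) => ij; last first.
    apply: covered_le (covered0 _ _ _ _) _ _; first by move=> x []; rewrite leqNgt ij.
    by rewrite mulr_ge0// ltW// expR_gt0.
  (* The four factors are the times before [i], the return from [i] to [j],
     the time [j] itself, and the times after [j]. *)
  have := covered_cat (covered_cat (covered_cat (cD i) (cR p (j - i)%N)) cD1)
    (cD (n - j.+1)%N).
  rewrite subnKC// addn1 subnKC// => cn; apply: covered_le cn _ _.
    by move=> x [].
  have -> : D * expR (c1 * i%:R) * (D0 * expR (c' * (j - i)%:R)) * D1 *
      (D * expR (c1 * (n - j.+1)%:R)) = D * D0 * D1 * D *
      (expR (c1 * i%:R) * expR (c' * (j - i)%:R) * expR (c1 * (n - j.+1)%:R)) by ring.
  rewrite /K -[leRHS]mulrA ler_wpM2l//; first by rewrite !mulr_ge0.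
  rewrite -!expRD ler_expR !natrB// -natr1.
  have : 0 <= eta * (j%:R - i%:R) by rewrite mulr_ge0 ?(ltW eta0)// subr_ge0 ler_nat.
  have := ler_norm (- c1); rewrite normrN /c1; lra.
have := covered_bigcup (fun i (_ : (i < n)%N) => covered_bigcup (cZ i)).
move=> /(coveredU (cD n)) cU; apply: covered_le cU _ _.
  by move=> x /confined_cons.
have -> : c'' = c1 + 2 * eta by rewrite /c1 /eta; field.
have nE := natr_le_expR n eta0; have E1 := expR_ge1Dx (eta * n%:R).
set E := expR (eta * n%:R) in nE E1.
have {}E1 : 1 <= E by apply: le_trans E1; rewrite lerDl mulr_ge0// ltW.
have -> : expR ((c1 + 2 * eta) * n%:R) = E ^+ 2 * expR (c1 * n%:R).
  by rewrite -expRM_natl -expRD; congr expR; ring.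
set F := expR (c1 * n%:R); have F0 : 0 <= F by rewrite ltW// expR_gt0.
rewrite mulrDl lerD//.
  by rewrite ler_wpM2l// ler_peMl// exprn_ege1.
have -> : n%:R * (n%:R * (K * F)) = n%:R ^+ 2 * (K * F) by ring.
have -> : K / eta ^+ 2 * (E ^+ 2 * F) = (eta^-1 * E) ^+ 2 * (K * F).
  by field; rewrite gt_eqF.
by rewrite ler_wpM2r ?mulr_ge0// lerXn2r// nnegrE// (le_trans _ nE).
Qed.

(** By compactness every orbit is confined to the balls of radius [alpha / 2]
    around finitely many points, so that the bound on confined orbits applies
    to all of them. *)
Lemma growth_rate_orbits_le_PPO (S : R -> R) (e om c alpha : R) :
  0 < e -> 0 <= S (2 * e) -> 0 < alpha ->
  (forall a b, mdist a b <= e -> `|f a - f b| <= om) ->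
  (growth_rate (fun n => PPOSep T f S n e alpha) < c%:E)%E ->
  (growth_rate (fun n => Sep T f S n (2 * e)) <=
    (c + (S (2 * e) * om + M * `|S (2 * e) - S e|))%:E)%E.
Proof.
move=> e0 s0 alpha0 fom gc; set c' := c + _; apply/lee_addgt0Pr => eta eta0; rewrite -EFinD.
have c'eta : c' < c' + eta by rewrite ltrDl.
have e20 : 0 < 2 * e by rewrite mulr_gt0.
have r0 : 0 < alpha / 2 by rewrite divr_gt0.
have [D0 cR] : exists D, forall p l, covered f (S (2 * e)) l (2 * e) (returns p (alpha / 2) l)
    (D * expR (c' * l%:R)).
  by apply: covered_returns => //; rewrite [2 * _]mulrC divfK.
have [L HL] := compact_totally_bounded X_compact r0.
have [D cD] := covered_confined L e20 cR c'eta.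
apply: growth_rate_le => n; rewrite (Sep_orbits _ _ _ _ (ltW e20)).
apply: seqSep_covered; apply: covered_le (cD n) _ (lexx _).
by move=> x xo; split=> // i _; exact: HL.
Qed.

End Recurrence.

(** * Limits in the scale *)

Section Scale.
Context {R : realType}.

Lemma lee_real_upper (x y : \bar R) :
  (forall c : R, (y < c%:E)%E -> (x <= c%:E)%E) -> (x <= y)%E.
Proof.
case: x y => [r| |] [t| |] //= H; rewrite ?leey ?leNye//.
- apply/lee_addgt0Pr => e e0; rewrite -EFinD; apply: H.
  by rewrite lte_fin ltrDl.
- by have := H (r - 1) (ltNyr _); rewrite lee_fin => ?; exfalso; lra.
- by have := H (t + 1); rewrite lte_fin ltrDl ltr01 => /(_ isT).
- by have := H 0 (ltNyr _).
Qed.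

Lemma near0_scale (mu : R) (P : set R) : 0 < mu ->
  (\forall x \near 0^'+, P x) -> \forall x \near 0^'+, P (mu * x).
Proof.
move=> mu0 [d /= d0 dP]; exists (d / mu); first by rewrite /= divr_gt0.
move=> x /=; rewrite sub0r normrN => xd x0.
apply: dP => /=; last by rewrite mulr_gt0.
by rewrite sub0r normrN normrM gtr0_norm// mulrC -ltr_pdivlMr.
Qed.

Lemma lim_at_right0_inf (g : R -> \bar R) :
  (forall a b, 0 < a -> a <= b -> (g a <= g b)%E) ->
  lim (g a @[a --> 0^'+]) = ereal_inf (g @` [set a | 0 < a]).
Proof.
move=> g_nd; have -> : [set a : R | 0 < a] = [set` Interval (BRight 0) (BInfty R false)].
  by apply/seteqP; split=> a /=; rewrite in_itv /= andbT.
apply: cvg_lim => //; apply: nondecreasing_at_right_cvge => // a b.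
by rewrite !in_itv /= !andbT => a0 _; exact: g_nd.
Qed.

Lemma le_limf_esup_scaled (S : R -> R) (H H' : R -> \bar R) :
  scale_function S -> (forall e, 0 < e -> (H e <= H' e)%E) ->
  (limf_esup (fun e => H e / (S e)%:E) 0^'+ <=
   limf_esup (fun e => H' e / (S e)%:E) 0^'+)%E.
Proof.
move=> [S0 _] HH'; apply: le_limf_esup; near=> e.
have e0 : 0 < e by near: e; exact: nbhs_right_gt.
have e1 : e < 1 by near: e; exact: nbhs_right_lt.
have Se : 0 < S e by rewrite S0// e0.
apply: lee_wpmul2r; last exact: HH'.
by rewrite inver gt_eqF// lee_fin invr_ge0 ltW.
Unshelve. all: by end_near. Qed.

(** This is where the scale functions enter: since [S (mu * x) / S x] tends
    to [1], a change of scale by a constant factor, and errors that are small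
    compared with [S], are invisible in the upper limit. *)
Lemma limf_esup_scaled_le (S : R -> R) (lam M : R) (H H' : R -> \bar R) :
  scale_function S -> 0 < lam -> 0 <= M ->
  (forall om, 0 < om -> \forall e \near 0^'+, forall c : R, (H' e < c%:E)%E ->
    (H (lam * e)%R <= (c + (S (lam * e) * om + M * `|S (lam * e) - S e|))%:E)%E) ->
  (limf_esup (fun e => H e / (S e)%:E) 0^'+ <=
   limf_esup (fun e => H' e / (S e)%:E) 0^'+)%E.
Proof.
move=> [S0 S1] lam0 M0 HH'; apply: lee_real_upper => c /limf_esup_lt H'c.
apply/lee_addgt0Pr => delta delta0; rewrite -EFinD; apply: limf_esup_le.
pose mu := lam^-1; have mu0 : 0 < mu by rewrite invr_gt0.
have d2 : 0 < delta / 2 by rewrite divr_gt0.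
have C0 : 0 < `|c| + M + 1 by rewrite ltr_wpDl// addr_ge0.
pose zeta := delta / 2 / (`|c| + M + 1).
have zeta0 : 0 < zeta by rewrite divr_gt0.
have zetaE : (`|c| + M + 1) * zeta = delta / 2 by rewrite mulrC divfK// gt_eqF.
have q_near := (cvgrPdist_lt _ _).1 (S1 mu mu0) zeta zeta0.
near=> x.
have x0 : 0 < x by near: x; exact: nbhs_right_gt.
have x1 : x < 1 by near: x; exact: nbhs_right_lt.
have mux1 : mu * x < 1.
  by near: x; apply: (near0_scale (P := fun x => x < 1)) => //; exact: nbhs_right_lt.
have Sx : 0 < S x by rewrite S0// x0.
have Smux : 0 < S (mu * x) by rewrite S0// mulr_gt0.
have q_lt : `|1 - S (mu * x) / S x| < zeta by near: x; exact: q_near.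
have : (H' (mu * x)%R / (S (mu * x))%:E < c%:E)%E.
  by near: x; apply: (near0_scale (P := fun x => H' x / (S x)%:E < c%:E)%E).
rewrite inver gt_eqF// lte_pdivrMr// => H'x.
have : forall c : R, (H' (mu * x)%R < c%:E)%E -> (H (lam * (mu * x))%R <=
    (c + (S (lam * (mu * x)) * (delta / 2) +
      M * `|S (lam * (mu * x)) - S (mu * x)|))%:E)%E.
  near: x; exact: near0_scale mu0 (HH' _ d2).
move=> /(_ (c * S (mu * x))%R); rewrite EFinM => /(_ H'x).
rewrite mulVKf ?gt_eqF// => Hx; rewrite inver gt_eqF// lee_pdivrMr//.
apply: le_trans Hx _; rewrite -EFinM lee_fin.
set q := S (mu * x) / S x in q_lt.
have qE : S (mu * x) = q * S x by rewrite /q divfK// gt_eqF.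
rewrite qE -[X in `|X - _|]mul1r -mulrBl normrM (gtr0_norm Sx).
have -> : c * (q * S x) + (S x * (delta / 2) + M * (`|1 - q| * S x)) =
  (c * q + delta / 2 + M * `|1 - q|) * S x by ring.
rewrite ler_pM2r//.
have : c * (q - 1) <= `|c| * `|1 - q|.
  by apply: le_trans (ler_norm _) _; rewrite normrM (distrC q).
have : (`|c| + M) * `|1 - q| <= (`|c| + M + 1) * zeta.
  by apply: ler_pM => //; [exact: addr_ge0|rewrite lerDl|exact: ltW].
lra.
Unshelve. all: by end_near. Qed.

End Scale.

Section Comparison.
Context {R : realType} {X : metricType R} (T : X -> X) (f : X -> R) (S : R -> R).

Lemma seqSep_subset n e (Y Z : set (nat -> X)) : Y `<=` Z ->
  (seqSep f S n e Y <= seqSep f S n e Z)%E.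
Proof.
move=> YZ; apply: ereal_sup_le => _ [E [EY sE] <-]; exists E => //.
by split=> //; exact: subset_trans YZ.
Qed.

Lemma PO_subset (a b : R) : a <= b -> PO T a `<=` PO T b.
Proof. by move=> ab x xa i; apply: le_trans ab. Qed.

Lemma lim_POSep e : lim (growth_rate (fun n => POSep T f S n e a) @[a --> 0^'+]) =
  ereal_inf ((fun a => growth_rate (fun n => POSep T f S n e a)) @` [set a | 0 < a]).
Proof.
apply: lim_at_right0_inf => a b _ ab; apply: le_growth_rate => n.
exact/seqSep_subset/PO_subset.
Qed.

Lemma lim_PPOSep e : lim (growth_rate (fun n => PPOSep T f S n e a) @[a --> 0^'+]) =
  ereal_inf ((fun a => growth_rate (fun n => PPOSep T f S n e a)) @` [set a | 0 < a]).
Proof.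
apply: lim_at_right0_inf => a b _ ab; apply: le_growth_rate => n.
by apply: seqSep_subset => x [xa xn]; split=> //; exact: PO_subset xa.
Qed.

Context (S_scale : scale_function S).

Lemma Sdim_le_PSdim : (Sdim T f S <= PSdim T f S)%E.
Proof.
rewrite /Sdim /PSdim; apply: (le_limf_esup_scaled S_scale) => e e0.
rewrite lim_POSep.
apply: le_ereal_inf_tmp => _ [a a0 <-]; apply: le_growth_rate => n.
by rewrite (Sep_orbits _ _ _ _ (ltW e0)); apply/seqSep_subset/orbits_sub_PO/ltW.
Qed.

Lemma PPSdim_le_PSdim : (PPSdim T f S <= PSdim T f S)%E.
Proof.
rewrite /PPSdim /PSdim; apply: (le_limf_esup_scaled S_scale) => e e0.
rewrite lim_POSep lim_PPOSep.
apply: le_ereal_inf_tmp => _ [a a0 <-].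
apply: le_trans (ereal_inf_lbound _) _; first by exists a.
by apply: le_growth_rate => n; apply: seqSep_subset => x [].
Qed.

Context (X_compact : compact [set: X]) (T_cont : continuous T) (f_cont : continuous f).

Lemma modulus_near0 (om : R) : 0 < om ->
  \forall e \near 0^'+, forall a b, mdist a b <= e -> `|f a - f b| <= om.
Proof.
move=> om0; have [d d0 df] := compact_uniform_continuity X_compact f_cont om0.
near=> e => a b abe; apply/ltW/df; apply: le_lt_trans abe _.
by near: e; exact: nbhs_right_lt.
Unshelve. all: by end_near. Qed.

Lemma scale_gt0_near0 (lam : R) : 0 < lam ->
  \forall e \near 0^'+, 0 < S (lam * e).
Proof.
move=> lam0; apply: (near0_scale (P := fun e => 0 < S e)) => //.
near=> e; apply: S_scale.1.
by apply/andP; split; near: e; [exact: nbhs_right_gt|exact: nbhs_right_lt].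
Unshelve. all: by end_near. Qed.

Lemma PSdim_le_Sdim : (PSdim T f S <= Sdim T f S)%E.
Proof.
have [M M0 fM] := compact_bounded_fun X_compact f_cont.
apply: (@limf_esup_scaled_le _ S 4 M) => // om om0.
have om2 : 0 < om / 2 by rewrite divr_gt0.
near=> e => c gc.
have e0 : 0 < e by near: e; exact: nbhs_right_gt.
have s0 : 0 < S (4 * e) by near: e; exact: scale_gt0_near0.
have fom : forall a b, mdist a b <= e -> `|f a - f b| <= om / 2.
  by near: e; exact: modulus_near0.
have gc' : (growth_rate (fun n => seqSep f S n e (orbits T)) < c%:E)%E.
  by apply: le_lt_trans gc; apply: le_growth_rate => n; rewrite Sep_orbits// ltW.
have [alpha alpha0 [D cD]] := covered_PO_rate X_compact T_cont fM e0 (ltW s0) fom gc'.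
rewrite lim_POSep; apply: le_trans (ereal_inf_lbound _) _; first by exists alpha.
apply: (@growth_rate_le _ _ D) => n; apply: le_trans (seqSep_covered (cD n)) _.
have -> // : c + 2 * (S (4 * e) * (om / 2)) + M * `|S (4 * e) - S e| =
  c + (S (4 * e) * om + M * `|S (4 * e) - S e|) by field.
Unshelve. all: by end_near. Qed.

Lemma Sdim_le_PPSdim : (Sdim T f S <= PPSdim T f S)%E.
Proof.
have [M M0 fM] := compact_bounded_fun X_compact f_cont.
apply: (@limf_esup_scaled_le _ S 2 M) => // om om0.
near=> e => c; rewrite lim_PPOSep => /ereal_inf_lt[_ [alpha alpha0 <-] gc].
have e0 : 0 < e by near: e; exact: nbhs_right_gt.
have s0 : 0 < S (2 * e) by near: e; exact: scale_gt0_near0.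
have fom : forall a b, mdist a b <= e -> `|f a - f b| <= om.
  by near: e; exact: modulus_near0.
have H := growth_rate_orbits_le_PPO X_compact fM e0 (ltW s0) alpha0.
exact: (H T om c fom gc).
Unshelve. all: by end_near. Qed.

End Comparison.

(** * Equality of the three scaled pressures *)

Unset Implicit Arguments.

Theorem theorem2p9 (R : realType) (X : metricType R) (T : X -> X) (f : X -> R)
    (S : R -> R) (X_compact : compact [set: X]) (T_cont : continuous T)
    (f_cont : continuous f) (S_scale : scale_function S) :
  Sdim T f S = PSdim T f S /\
  ((forall x, 0 <= f x) ->
   (forall x y : R, 0 < x -> x <= y -> y < 1 -> S y <= S x) ->
   Sdim T f S = PPSdim T f S).
Proof.
have S_PS := Sdim_le_PSdim T f S_scale.
have PS_S := PSdim_le_Sdim S_scale X_compact T_cont f_cont.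
have PPS_PS := PPSdim_le_PSdim T f S_scale.
have S_PPS := Sdim_le_PPSdim T S_scale X_compact f_cont.
split=> [|_ _]; apply/eqP; rewrite eq_le; apply/andP; split.
- exact: S_PS.
- exact: PS_S.
- exact: S_PPS.
- exact: le_trans PPS_PS PS_S.
Qed.
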